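(* Let $\Lambda$ be a lattice and let $f$ and $g$ be polynomials on $\Lambda$ with $g$ homogeneous. Then the assignment $T^u\mapsto \exp(\partial_u)$ ($u\in\Lambda$) defines an isomorphism $\mathrm{ch}\colon \mathbb{Q}K_f\to \mathbb{Q}A_g$ if and only if there exists a unit $\mathrm{td}\in(\mathbb{Q}A_g)^\times$ such that $\mathrm{td}\cdot g=f$, or equivalently such that $$\chi_f(E)=\deg_g(\mathrm{td}\cdot \mathrm{ch}(E))\qquad\text{for all }E\in \mathrm{Sh}_{\mathbb{Q}}(\Lambda).$$
   Context: A lattice $\Lambda$ is a free abelian group of finite rank. $P(\Lambda)$ denotes the ring of polynomial functions $\Lambda\to\mathbb{Q}$ with rational coefficients; ''polynomial on $\Lambda$'' means an element of $P(\Lambda)$. $\mathrm{Sh}(\Lambda)=\mathbb{Z}[\Lambda]$ is the group ring with basis $T^u$, $u\in\Lambda$, acting on functions $h$ on $\Lambda$ by $(T^uh)(x)=h(x+u)$. $\mathrm{Diff}(\Lambda)$ is the ring of differential operators with constant integer coefficients ($\cong\mathbb{Z}[\partial/\partial x_1,\dots,\partial/\partial x_n]$ in a basis of $\Lambda$ with dual coordinates $x_i$), acting on $P(\Lambda)$; $\partial_u$ is the directional derivative along $u$. For a ring $R$ write $\mathbb{Q}R=\mathbb{Q}\otimes_{\mathbb{Z}}R$, and $\mathrm{Sh}_{\mathbb{Q}}(\Lambda)=\mathbb{Q}\,\mathrm{Sh}(\Lambda)$. $K_f=\mathrm{Sh}(\Lambda)/\mathrm{Ann}(f)$ and $A_g=\mathrm{Diff}(\Lambda)/\mathrm{Ann}(g)$,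 where $\mathrm{Ann}$ denotes the ideal of operators killing the polynomial. $\chi_f(E)=(E\cdot f)(0)$ for $E\in\mathrm{Sh}_{\mathbb{Q}}(\Lambda)$ (this depends only on the class of $E$ in $\mathbb{Q}K_f$), and $\deg_g([D])=(D\cdot g)(0)$ for $[D]\in \mathbb{Q}A_g$. For $\alpha=[D]\in\mathbb{Q}A_g$, $\alpha\cdot g:=D\cdot g$. The classes $[\partial_u]\in \mathbb{Q}A_g$ are nilpotent, and $\mathrm{ch}\colon \mathrm{Sh}_{\mathbb{Q}}(\Lambda)\to\mathbb{Q}A_g$ is the $\mathbb{Q}$-algebra homomorphism with $\mathrm{ch}(T^u)=\exp([\partial_u])=\sum_{i\ge0}[\partial_u]^i/i!$. That it ''defines an isomorphism $\mathbb{Q}K_f\to\mathbb{Q}A_g$'' means that it factors through the quotient $\mathbb{Q}K_f$ of $\mathrm{Sh}_{\mathbb{Q}}(\Lambda)$ and that the induced map is an isomorphism. *)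

(* Defs.v *)
From HB Require Import structures.
From mathcomp Require Import all_boot all_order all_algebra.
(* monalg and mpoly declare clashing notations: only mpoly's are loaded, and
   the operations of monalg are written qualified. *)
From mathcomp Require Import -(notations) finmap monalg.
From mathcomp Require Import mpoly.
From mathcomp Require Import boolp.

Set Implicit Arguments.
Unset Strict Implicit.
Unset Printing Implicit Defensive.

Import GRing.Theory Num.Theory.

Local Open Scope ring_scope.
Local Open Scope quotient_scope.

(* The ideals of ring_quotient.v are proper; here the whole ring has to be
   allowed (it is the annihilator of the zero polynomial), so that the quotient
   may be the zero ring. Its additive structure is the one of ring_quotient.v. *)

HB.mixin Record isMulIdeal (R : comNzRingType) (S : R -> bool) := {
  mulideal_subproof : forall a, {in S, forall u, a * u \in S}
}.

#[short(type="ideal")]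
HB.structure Definition Ideal (R : comNzRingType) :=
  {S of GRing.ZmodClosed R S & isMulIdeal R S}.

(* [GRing.unit] is not available on rings that may be zero *)
Definition is_unit (R : comPzRingType) (a : R) : Prop := exists b, a * b = 1.

Section QuotientRing.
Variables (F : comNzRingType) (A : comAlgType F) (I : ideal A).

Definition quot_ring : Type := Quotient.quot I.

HB.instance Definition _ := GRing.Zmodule.on quot_ring.

Definition quot_pi (a : A) : quot_ring := \pi_(Quotient.quot I) a.
Definition quot_repr (x : quot_ring) : A := repr (x : Quotient.quot I).

Lemma quot_reprK (x : quot_ring) : quot_pi (quot_repr x) = x.
Proof. exact: reprK. Qed.

Lemma quot_piP (a b : A) : reflect (quot_pi a = quot_pi b) (a - b \in I).
Proof. by rewrite Quotient.idealrBE; apply: eqP. Qed.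

Lemma quot_pi_reprP (a : A) : quot_repr (quot_pi a) - a \in I.
Proof. by apply/quot_piP; rewrite quot_reprK. Qed.

Lemma quot_pi_is_zmod_morphism : zmod_morphism quot_pi.
Proof. exact: pi_is_zmod_morphism. Qed.

HB.instance Definition _ :=
  GRing.isZmodMorphism.Build A quot_ring quot_pi quot_pi_is_zmod_morphism.

Lemma idealMl a u : u \in I -> a * u \in I.
Proof. exact: mulideal_subproof. Qed.

Definition quot_one : quot_ring := quot_pi 1.
Definition quot_mul (x y : quot_ring) : quot_ring :=
  quot_pi (quot_repr x * quot_repr y).
Definition quot_scale (c : F) (x : quot_ring) : quot_ring :=
  quot_pi (c *: quot_repr x).

Lemma quot_piM a b : quot_pi (a * b) = quot_mul (quot_pi a) (quot_pi b).
Proof.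
apply/esym/quot_piP; set a' := quot_repr _; set b' := quot_repr _.
have -> : a' * b' - a * b = a' * (b' - b) + b * (a' - a).
  by rewrite !mulrBr addrA [b * a']mulrC subrK [b * a]mulrC.
by rewrite rpredD // idealMl ?quot_pi_reprP.
Qed.

Lemma quot_piZ c a : quot_pi (c *: a) = quot_scale c (quot_pi a).
Proof.
apply/esym/quot_piP; rewrite -scalerBr -mulr_algl.
exact/idealMl/quot_pi_reprP.
Qed.

Lemma quot_mulA : associative quot_mul.
Proof.
move=> x y z; rewrite -[x]quot_reprK -[y]quot_reprK -[z]quot_reprK.
by rewrite -!quot_piM mulrA.
Qed.

Lemma quot_mulC : commutative quot_mul.
Proof. by move=> x y; rewrite /quot_mul mulrC. Qed.

Lemma quot_mul1 : left_id quot_one quot_mul.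
Proof. by move=> x; rewrite -[x]quot_reprK -quot_piM mul1r. Qed.

Lemma quot_mulDl : left_distributive quot_mul +%R.
Proof.
move=> x y z; rewrite -[x]quot_reprK -[y]quot_reprK -[z]quot_reprK.
by rewrite -raddfD -!quot_piM mulrDl raddfD.
Qed.

HB.instance Definition _ := GRing.Zmodule_isComPzRing.Build quot_ring
  quot_mulA quot_mulC quot_mul1 quot_mulDl.

Lemma quot_scaleA a b x : quot_scale a (quot_scale b x) = quot_scale (a * b) x.
Proof. by rewrite -[x]quot_reprK -!quot_piZ scalerA. Qed.

Lemma quot_scale1 : left_id 1 quot_scale.
Proof. by move=> x; rewrite -[x]quot_reprK -quot_piZ scale1r. Qed.

Lemma quot_scaleDr : right_distributive quot_scale +%R.
Proof.
move=> c x y; rewrite -[x]quot_reprK -[y]quot_reprK.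
by rewrite -raddfD -!quot_piZ scalerDr raddfD.
Qed.

Lemma quot_scaleDl x : {morph quot_scale^~ x : a b / a + b}.
Proof.
by move=> a b; rewrite -[x]quot_reprK -!quot_piZ scalerDl raddfD.
Qed.

HB.instance Definition _ := GRing.Zmodule_isLmodule.Build F quot_ring
  quot_scaleA quot_scale1 quot_scaleDr quot_scaleDl.

Lemma quot_pi_is_monoid_morphism : monoid_morphism quot_pi.
Proof. by split=> // a b; rewrite quot_piM. Qed.

HB.instance Definition _ :=
  GRing.isMonoidMorphism.Build A quot_ring quot_pi quot_pi_is_monoid_morphism.

Lemma quot_pi_is_scalable : scalable quot_pi.
Proof. by move=> c a; rewrite quot_piZ. Qed.

HB.instance Definition _ :=
  GRing.isScalable.Build F A quot_ring *:%R quot_pi quot_pi_is_scalable.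

Lemma quot_scaleAl (c : F) (x y : quot_ring) : c *: (x * y) = c *: x * y.
Proof.
rewrite -[x]quot_reprK -[y]quot_reprK.
by rewrite -rmorphM -!linearZ -rmorphM /= scalerAl.
Qed.

End QuotientRing.

(* monalg only multiplies families indexed by a monoid without nontrivial units,
   so the group ring shares its module structure but not its product. *)
Definition group_ring (R : comNzRingType) (L : zmodType) : Type :=
  monalg.malg L R.

HB.instance Definition _ (R : comNzRingType) (L : zmodType) :=
  GRing.Lmodule.on (group_ring R L).

Section GroupRing.
Variables (R : comNzRingType) (L : zmodType).
Implicit Types E : group_ring R L.

Definition coefg (u : L) (E : group_ring R L) : R := monalg.mcoeff u E.
Definition suppg (E : group_ring R L) : seq L := monalg.msupp E.

Definition shift (u : L) : group_ring R L := monalg.mkmalgU u 1.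

Lemma coefg_is_linear u : linear_for *%R (coefg u).
Proof. by move=> c E1 E2; rewrite /coefg monalg.mcoeffD monalg.mcoeffZ. Qed.

HB.instance Definition _ u :=
  GRing.isLinear.Build R (group_ring R L) R *%R (coefg u) (coefg_is_linear u).

Lemma coefg_shift u v : coefg v (shift u) = (u == v)%:R.
Proof. exact: monalg.mcoeffU. Qed.

Lemma coefgP E1 E2 : (forall u, coefg u E1 = coefg u E2) -> E1 = E2.
Proof. by move=> h; apply/monalg.malgP. Qed.

Lemma group_ringE E : E = \sum_(u <- suppg E) coefg u E *: shift u.
Proof.
rewrite [LHS]monalg.monalgE; apply: eq_bigr => u _.
by apply/coefgP=> v; rewrite linearZ /= coefg_shift /coefg monalg.mcoeffU mulr_natr.
Qed.

Section Lift.
Variables (V : lmodType R) (h : L -> V).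

Definition gr_lift E : V := \sum_(u <- suppg E) coefg u E *: h u.

Lemma gr_liftEw (d : finmap.finset_of (Phant L)) E :
  finmap.fsubset (monalg.msupp E) d -> gr_lift E = \sum_(u <- d) coefg u E *: h u.
Proof.
move=> le; rewrite /gr_lift /suppg (finmap.big_fset_incl _ le) //=.
by move=> u _ /monalg.mcoeff_outdom Eu; rewrite /coefg Eu scale0r.
Qed.

Lemma gr_lift_is_linear : linear gr_lift.
Proof.
move=> c E1 E2.
pose d := finmap.fsetU (finmap.fsetU (monalg.msupp E1) (monalg.msupp E2))
                       (monalg.msupp (c *: E1 + E2 : group_ring R L)).
have d1 : finmap.fsubset (monalg.msupp E1) d.
  exact: finmap.fsubset_trans (finmap.fsubsetUl _ _) (finmap.fsubsetUl _ _).
have d2 : finmap.fsubset (monalg.msupp E2) d.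
  exact: finmap.fsubset_trans (finmap.fsubsetUr _ _) (finmap.fsubsetUl _ _).
rewrite (gr_liftEw d1) (gr_liftEw d2) (@gr_liftEw d) ?finmap.fsubsetUr //.
rewrite scaler_sumr -big_split; apply: eq_bigr => u _ /=.
by rewrite linearP scalerDl scalerA.
Qed.

HB.instance Definition _ := GRing.isLinear.Build R (group_ring R L) V *:%R
  gr_lift gr_lift_is_linear.

Lemma gr_lift_shift u : gr_lift (shift u) = h u.
Proof.
have /gr_liftEw -> := @monalg.msuppU_le L R u 1.
by rewrite finmap.big_seq_fset1 coefg_shift eqxx scale1r.
Qed.

End Lift.

Lemma gr_ext (V : lmodType R) (f g : group_ring R L -> V) :
  linear f -> linear g -> (forall u, f (shift u) = g (shift u)) -> f =1 g.
Proof.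
move=> lf lg fg E.
pose Lf := GRing.isLinear.Build R (group_ring R L) V *:%R f lf.
pose Lg := GRing.isLinear.Build R (group_ring R L) V *:%R g lg.
pose f' : {linear group_ring R L -> V} := HB.pack f Lf.
pose g' : {linear group_ring R L -> V} := HB.pack g Lg.
rewrite -[f]/(f' : _ -> _) -[g]/(g' : _ -> _) [E]group_ringE !linear_sum.
by apply: eq_bigr => u _; rewrite !linearZ /= fg.
Qed.

Definition gr_mul E1 E2 : group_ring R L :=
  gr_lift (fun u => gr_lift (fun v => shift (u + v)) E2) E1.

Lemma gr_mul_shift u v : gr_mul (shift u) (shift v) = shift (u + v).
Proof. by rewrite /gr_mul !gr_lift_shift. Qed.

Lemma gr_mul_linl E2 : linear (gr_mul^~ E2).
Proof. by move=> c E E'; rewrite /gr_mul linearP. Qed.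

Lemma gr_mul_linr E1 : linear (gr_mul E1).
Proof.
move=> c E E'; rewrite /gr_mul {1}/gr_lift.
under eq_bigr do rewrite linearP scalerDr scalerA mulrC -scalerA.
by rewrite big_split /= -scaler_sumr.
Qed.

Lemma gr_mulC : commutative gr_mul.
Proof.
move=> E1 E2; move: E1; apply: gr_ext => [||u]; rewrite ?gr_mul_shift.
- exact: gr_mul_linl.
- exact: gr_mul_linr.
move: E2; apply: gr_ext => [||v]; first exact: gr_mul_linr.
- exact: gr_mul_linl.
by rewrite !gr_mul_shift addrC.
Qed.

Lemma gr_mulA : associative gr_mul.
Proof.
move=> E1 E2 E3; move: E1; apply: gr_ext => [||u].
- exact: gr_mul_linl.
- by move=> c E E'; rewrite !gr_mul_linl.
move: E2; apply: gr_ext => [||v].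
- by move=> c E E'; rewrite gr_mul_linl gr_mul_linr.
- by move=> c E E'; rewrite gr_mul_linr gr_mul_linl.
move: E3; apply: gr_ext => [||w].
- by move=> c E E'; rewrite !gr_mul_linr.
- exact: gr_mul_linr.
by rewrite !gr_mul_shift addrA.
Qed.

Lemma gr_mul1 : left_id (shift 0) gr_mul.
Proof.
apply: gr_ext => [||u]; [exact: gr_mul_linr | by [] |].
by rewrite gr_mul_shift add0r.
Qed.

Lemma gr_mulDl : left_distributive gr_mul +%R.
Proof. by move=> E E' E2; rewrite -[E]scale1r gr_mul_linl !scale1r. Qed.

Lemma gr_oner_neq0 : shift 0 != 0 :> group_ring R L.
Proof.
apply/eqP => /(congr1 (coefg 0)); rewrite coefg_shift eqxx linear0.
exact/eqP/oner_neq0.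
Qed.

HB.instance Definition _ := GRing.Zmodule_isComNzRing.Build (group_ring R L)
  gr_mulA gr_mulC gr_mul1 gr_mulDl gr_oner_neq0.

Lemma gr_scaleAl (c : R) (E1 E2 : group_ring R L) :
  c *: (E1 * E2) = c *: E1 * E2.
Proof. by rewrite -[RHS]/(gr_mul (c *: E1) E2) /gr_mul linearZ. Qed.

HB.instance Definition _ :=
  GRing.Lmodule_isLalgebra.Build R (group_ring R L) gr_scaleAl.
HB.instance Definition _ :=
  GRing.Lalgebra_isComAlgebra.Build R (group_ring R L).

Lemma shiftD u v : shift (u + v) = shift u * shift v.
Proof. by rewrite [RHS]gr_mul_shift. Qed.

End GroupRing.

Arguments shift {R L} u.

Section IntegerPoints.
Variable n : nat.
Implicit Types (p : {mpoly rat[n]}) (x : 'I_n -> int).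

Let line x (i : 'I_n) (j : 'I_n) : {poly rat} :=
  (x j)%:~R%:P + (j == i)%:R *: 'X.

Lemma horner_line x i p (t : int) :
  (mmap polyC (line x i) p).[t%:~R]
    = p.@[fun j => (x j + (j == i)%:R * t)%:~R].
Proof.
rewrite mevalE /mmap horner_sum; apply: eq_bigr => m _.
rewrite hornerM hornerC /mmap1 horner_prod; congr (_ * _).
apply: eq_bigr => j _; rewrite horner_exp /line hornerD hornerC hornerZ hornerX.
by rewrite rmorphD rmorphM /= rmorph_nat.
Qed.

Lemma deriv_line x i p :
  (mmap polyC (line x i) p)^`().[0] = p^`M(i).@[fun j => (x j)%:~R].
Proof.
elim/mpolyind: p => [|c m p _ _ IH].
  by rewrite mderiv0 meval0 mmap0 deriv0 horner0.
rewrite mmapD derivD hornerD IH mderivD mevalD; congr (_ + _).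
rewrite mmapZ derivM derivC mul0r add0r hornerM hornerC mderivZ mevalZ.
congr (_ * _); rewrite mmapX mderivX mevalZ mevalX /mmap1.
rewrite (bigD1 i) //= [in RHS](bigD1 i) //= /line eqxx scale1r.
have -> : \prod_(j < n | j != i) ((x j)%:~R%:P + (j == i)%:R *: 'X) ^+ m j
          = (\prod_(j < n | j != i) (x j)%:~R ^+ m j)%:P :> {poly rat}.
  rewrite rmorph_prod; apply: eq_bigr => j /negPf ->.
  by rewrite scale0r addr0 rmorphXn.
rewrite derivM derivC mulr0 addr0 hornerM hornerC deriv_exp !hornerE.
rewrite derivD derivC derivX add0r mul1r hornerMn horner_exp !hornerE /=.
rewrite mnmBE mnm1E eqxx subn1 -mulr_natl -!mulrA; congr (_ * (_ * _)).
apply: eq_bigr => j /negPf ji; rewrite mnmBE mnm1E eq_sym ji subn0 //.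
Qed.

Lemma msize_mderiv i p : (msize p^`M(i) <= (msize p).-1)%N.
Proof.
rewrite [msize p^`M(i)]msizeE; apply/bigmax_leqP_seq => m + _.
rewrite mcoeff_msupp mcoeff_deriv mulrn_eq0 /= -mcoeff_msupp.
by move=> /msize_mdeg_lt; rewrite mdegD mdeg1 addn1; case: (msize p).
Qed.

Lemma mpoly_int_eq0 p : (forall x, p.@[fun j => (x j)%:~R] = 0) -> p = 0.
Proof.
have [k] := ubnP (msize p); elim: k p => // k IH p; rewrite ltnS => pk p0.
have [//|pN0] := eqVneq p 0.
have dp i : p^`M(i) = 0.
  apply: IH => [|x].
    apply: leq_trans pk; apply: leq_ltn_trans (msize_mderiv _ _) _.
    by rewrite prednK ?lt0n ?msize_poly_eq0.
  rewrite -deriv_line; suff -> : mmap polyC (line x i) p = 0.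
    by rewrite deriv0 horner0.
  set q := mmap _ _ _; apply/eqP/negPn/negP => qN0.
  suff: (size [seq t%:R : rat | t <- iota 0 (size q)] < size q)%N.
    by rewrite size_map size_iota ltnn.
  apply: max_poly_roots => //.
    apply/allP => _ /mapP[t _ ->]; rewrite /root -[t%:R]/((Posz t)%:~R).
    by rewrite horner_line p0.
  rewrite map_inj_uniq ?iota_uniq // => a b /eqP.
  by rewrite eqr_nat => /eqP.
have pC : p = (p@_0)%:MP.
  apply/mpolyP => m; rewrite mcoeffC; have [->|mN0] := eqVneq m 0%MM.
    by rewrite mulr1.
  have [i mi] : exists i, m i != 0%N.
    apply/existsP; apply: contraNT mN0 => /existsPn m0.
    by apply/eqP/mnmP => i; rewrite mnm0E; apply/eqP/negPn/m0.
  have := congr1 (mcoeff (m - U_(i))) (dp i).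
  rewrite mcoeff_deriv mcoeff0 submK; last first.
    by apply/mnm_lepP => j; rewrite mnm1E; case: eqP => // <-; rewrite lt0n.
  by move/eqP; rewrite mulrn_eq0 /= mulr0 => /eqP.
by move: (p0 (fun=> 0)); rewrite pC mevalC => ->.
Qed.
End IntegerPoints.

(* A lattice is a free Z-module of finite rank. The coordinates [v2r] that
   [vectType int] provides are those of some basis of [L]; the polynomial
   functions on [L] are the polynomials in them, and the variable ['X_i] of a
   differential operator stands for the derivative along the i-th one. *)
Notation polyOn L := {mpoly rat[dim L]}.
Notation Sh L := (group_ring int L).
Notation ShQ L := (group_ring rat L).
Notation Diff L := {mpoly int[dim L]}.
Notation DiffQ L := {mpoly rat[dim L]}.

Section Lattice.
Variable L : vectType int.

Definition coord (u : L) (i : 'I_(dim L)) : int :=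
  VectorInternalTheory.v2r u 0 i.

Definition pfun (h : polyOn L) (x : L) : rat := h.@[fun i => (coord x i)%:~R].

Lemma pfun_inj : injective pfun.
Proof.
move=> h h' e; apply/eqP; rewrite -subr_eq0; apply/eqP/mpoly_int_eq0 => x.
pose y := VectorInternalTheory.r2v (\row_i x i) : L.
have yE i : coord y i = x i by rewrite /coord VectorInternalTheory.r2vK mxE.
rewrite mevalB; apply/eqP; rewrite subr_eq0; apply/eqP.
have := congr1 (fun F => F y) e; rewrite /pfun.
by rewrite !(@meval_eq _ _ (fun i => (coord y i)%:~R) (fun i => (x i)%:~R)) // => i;
  rewrite yE.
Qed.

Definition sh_toQ (E : Sh L) : ShQ L :=
  \sum_(u <- suppg E) (coefg u E)%:~R *: shift u.

Definition sh_act (E : ShQ L) (h : L -> rat) (x : L) : rat :=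
  \sum_(u <- suppg E) coefg u E * h (x + u).

Definition diff_toQ (D : Diff L) : DiffQ L := map_mpoly intr D.

Definition diff_act (D : DiffQ L) (h : polyOn L) : polyOn L :=
  \sum_(m <- msupp D) D@_m *: h^`M[m].

Definition dirder (u : L) : DiffQ L := \sum_(i < dim L) (coord u i)%:~R *: 'X_i.

Definition Ann_sh (f : polyOn L) (E : Sh L) : Prop :=
  forall x, sh_act (sh_toQ E) (pfun f) x = 0.

(* Q (x) (R / J) is the quotient of Q (x) R by the Q-span of the image of J: the
   operators having a nonzero integer multiple that comes from J. *)
Definition QAnn_sh (f : polyOn L) : ShQ L -> bool := fun E =>
  `[< exists N E0, [/\ (0 < N)%N, E *+ N = sh_toQ E0 & Ann_sh f E0] >].

Definition Ann_diff (g : polyOn L) (D : Diff L) : Prop :=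
  diff_act (diff_toQ D) g = 0.

Definition QAnn_diff (g : polyOn L) : DiffQ L -> bool := fun D =>
  `[< exists N D0, [/\ (0 < N)%N, D *+ N = diff_toQ D0 & Ann_diff g D0] >].

Lemma clear_denom (s : seq rat) :
  exists2 N, (0 < N)%N & {in s, forall c, exists z : int, c *+ N = z%:~R}.
Proof.
elim: s => [|c s [N N0 IH]]; first by exists 1%N.
exists (`|denq c| * N)%N; first by rewrite muln_gt0 N0 absz_gt0 denq_neq0.
move=> d; rewrite inE => /predU1P[->|/IH[z zE]]; last first.
  by exists (z *+ `|denq c|); rewrite mulnC mulrnA zE rmorphMn.
exists (numq c *+ N); rewrite mulrnA rmorphMn /=; congr (_ *+ _).
rewrite -mulr_natr -[X in _ * X]/((`|denq c|%N : int)%:~R).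
by rewrite absz_denq numqE.
Qed.

Section ShAct.
Variable f : polyOn L.

Lemma sh_act_lift E (h : L -> rat) x :
  sh_act E h x = gr_lift (fun u => h (x + u) : rat^o) E.
Proof. by []. Qed.

Lemma sh_act_linear (h : L -> rat) x : linear_for *%R (fun E => sh_act E h x).
Proof. by move=> c E E'; rewrite !sh_act_lift linearP. Qed.

Lemma sh_actD E E' h x : sh_act (E + E') h x = sh_act E h x + sh_act E' h x.
Proof. by rewrite !sh_act_lift linearD. Qed.

Lemma sh_actN E h x : sh_act (- E) h x = - sh_act E h x.
Proof. by rewrite !sh_act_lift linearN. Qed.

Lemma sh_actMn E N h x : sh_act (E *+ N) h x = sh_act E h x *+ N.
Proof. by rewrite !sh_act_lift linearMn. Qed.

Lemma sh_act0 h x : sh_act 0 h x = 0.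
Proof. by rewrite sh_act_lift linear0. Qed.

Lemma sh_act_shift u h x : sh_act (shift u : ShQ L) h x = h (x + u).
Proof. by rewrite sh_act_lift gr_lift_shift. Qed.

Lemma sh_actM (E1 E2 : ShQ L) h x :
  sh_act (E1 * E2) h x = sh_act E1 (sh_act E2 h) x.
Proof.
move: E1; apply: (@gr_ext _ _ (rat^o)) => [||u].
- by move=> c E E'; rewrite mulrDl -scalerAl sh_act_linear.
- by move=> c E E'; rewrite sh_act_linear.
rewrite sh_act_shift; move: E2; apply: (@gr_ext _ _ (rat^o)) => [||v].
- by move=> c E E'; rewrite mulrDr -scalerAr sh_act_linear.
- by move=> c E E'; rewrite sh_act_linear.
by rewrite -shiftD !sh_act_shift addrA.
Qed.

Lemma coefg_sh_toQ u E : coefg u (sh_toQ E) = (coefg u E)%:~R.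
Proof.
rewrite /sh_toQ [in RHS](group_ringE E) !linear_sum (rmorph_sum intr) /=.
by apply: eq_bigr => v _; rewrite !linearZ /= !coefg_shift rmorphM /= rmorph_nat.
Qed.

Lemma sh_integral (E : ShQ L) :
  exists2 N, (0 < N)%N & exists E0, E *+ N = sh_toQ E0.
Proof.
have [N N0 EN] := clear_denom [seq coefg u E | u <- suppg E].
exists N => //; exists (\sum_(u <- suppg E) numq (coefg u E *+ N) *: shift u).
apply: coefgP => v; rewrite coefg_sh_toQ {1}[E]group_ringE -sumrMnl.
rewrite !linear_sum (rmorph_sum intr) big_seq [RHS]big_seq /=.
apply: eq_bigr => u uE; rewrite linearMn !linearZ /= !coefg_shift.
have [z zE] := EN _ (map_f (fun u => coefg u E) uE).
by rewrite rmorphM /= rmorph_nat -mulrnAl zE numq_int.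
Qed.

Lemma QAnn_shP E :
  reflect (forall x, sh_act E (pfun f) x = 0) (E \in QAnn_sh f).
Proof.
rewrite unfold_in; apply: (iffP (asboolP _)) => [[N [E0 [N0 NE E0f]]] x|Ef].
  move: (E0f x); rewrite -NE sh_actMn => /eqP.
  by rewrite mulrn_eq0 eqn0Ngt N0 => /eqP.
have [N N0 [E0 NE]] := sh_integral E.
by exists N, E0; split=> // x; rewrite -NE sh_actMn Ef mul0rn.
Qed.

Lemma QAnn_sh_zmod_closed : zmod_closed (QAnn_sh f).
Proof.
split=> [|E1 E2 /QAnn_shP E1f /QAnn_shP E2f]; apply/QAnn_shP => x.
  exact: sh_act0.
by rewrite sh_actD sh_actN E1f E2f subr0.
Qed.

Lemma QAnn_sh_mulideal E1 : {in QAnn_sh f, forall E2, E1 * E2 \in QAnn_sh f}.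
Proof.
move=> E2 /QAnn_shP E2f; apply/QAnn_shP => x; rewrite sh_actM.
have -> : sh_act E2 (pfun f) = fun=> 0 by apply/funext.
by rewrite /sh_act big1 // => u _; rewrite mulr0.
Qed.

HB.instance Definition _ :=
  GRing.isZmodClosed.Build (ShQ L) (QAnn_sh f) QAnn_sh_zmod_closed.
HB.instance Definition _ :=
  isMulIdeal.Build (ShQ L) (QAnn_sh f) QAnn_sh_mulideal.

Definition QK : Type := quot_ring (Ideal.clone (ShQ L) (QAnn_sh f) _).
HB.instance Definition _ := GRing.ComPzRing.on QK.
HB.instance Definition _ := GRing.Lmodule.on QK.

Definition QK_class : ShQ L -> QK :=
  @quot_pi _ _ (Ideal.clone (ShQ L) (QAnn_sh f) _).

Definition chi (E : ShQ L) : rat := sh_act E (pfun f) 0.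

End ShAct.

Section DiffAct.
Variable g : polyOn L.

Lemma diff_actEw k D h : (msize D <= k)%N ->
  diff_act D h = \sum_(m : 'X_{1..(dim L) < k}) D@_m *: h^`M[m].
Proof.
move=> le; pose I : subFinType _ := 'X_{1..(dim L) < k}.
rewrite /diff_act (ssrcomplements.big_mksub I) /=; first last.
- by move=> m /msize_mdeg_lt /leq_trans; apply.
- exact: msupp_uniq.
by rewrite big_rmcond //= => m /memN_msupp_eq0 ->; rewrite scale0r.
Qed.

Definition diff_actl h D := diff_act D h.

Lemma diff_act_linear h : linear (diff_actl h).
Proof.
move=> c D D'; rewrite /diff_actl.
pose k := maxn (msize (c *: D + D')) (maxn (msize D) (msize D')).
rewrite !(@diff_actEw k) ?leq_max ?leqnn ?orbT //.
rewrite scaler_sumr -big_split; apply: eq_bigr => m _ /=.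
by rewrite mcoeffD mcoeffZ scalerDl scalerA.
Qed.

Lemma diff_act_linearr D : linear (diff_act D).
Proof.
move=> c h h'; rewrite /diff_act scaler_sumr -big_split; apply: eq_bigr => m _.
by rewrite linearP /= scalerDr !scalerA mulrC.
Qed.

Lemma diff_actX m h : diff_act 'X_[m] h = h^`M[m].
Proof. by rewrite /diff_act msuppX big_seq1 mcoeffX eqxx scale1r. Qed.

HB.instance Definition _ h :=
  GRing.isLinear.Build rat (DiffQ L) (polyOn L) *:%R
    (diff_actl h) (diff_act_linear h).
HB.instance Definition _ D :=
  GRing.isLinear.Build rat (polyOn L) (polyOn L) *:%R
    (diff_act D) (diff_act_linearr D).

Lemma diff_actDl D D' h : diff_act (D + D') h = diff_act D h + diff_act D' h.
Proof. exact: (linearD (diff_actl h)). Qed.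

Lemma diff_actZl c D h : diff_act (c *: D) h = c *: diff_act D h.
Proof. exact: (linearZ_LR (diff_actl h)). Qed.

Lemma diff_act0l h : diff_act 0 h = 0.
Proof. exact: (linear0 (diff_actl h)). Qed.

Lemma diff_actNl D h : diff_act (- D) h = - diff_act D h.
Proof. exact: (linearN (diff_actl h)). Qed.

Lemma diff_actMnl D N h : diff_act (D *+ N) h = diff_act D h *+ N.
Proof. exact: (linearMn (diff_actl h)). Qed.

Lemma diff_act1 h : diff_act 1 h = h.
Proof. by rewrite -mpolyX0 diff_actX mderivm0m. Qed.

Lemma diff_actM D D' h : diff_act (D * D') h = diff_act D (diff_act D' h).
Proof.
move: D; apply: mpolyind => [|c m D _ _ IH]; first by rewrite mul0r !diff_act0l.
rewrite mulrDl !diff_actDl IH; congr (_ + _).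
rewrite -scalerAl !diff_actZl diff_actX; congr (_ *: _).
elim/mpolyind: D' {IH} => [|c' m' D' _ _ IH'].
  by rewrite mulr0 !diff_act0l linear0.
rewrite mulrDr !diff_actDl IH' linearD; congr (_ + _).
rewrite -scalerAr !diff_actZl linearZ -mpolyXD !diff_actX.
by rewrite addmC mderivmDm.
Qed.

Lemma diff_integral (D : DiffQ L) :
  exists2 N, (0 < N)%N & exists D0, D *+ N = diff_toQ D0.
Proof.
have [N N0 DN] := clear_denom [seq D@_m | m <- msupp D].
exists N => //; exists (\sum_(m <- msupp D) numq (D@_m *+ N) *: 'X_[m]).
apply/mpolyP => m'; rewrite mcoeff_map_mpoly {1}[D]mpolyE -sumrMnl.
rewrite !linear_sum raddf_sum big_seq [RHS]big_seq /=.
apply: eq_bigr => m mD; rewrite linearMn !linearZ /= !mcoeffX.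
have [z zE] := DN _ (map_f (fun m => D@_m) mD).
by rewrite rmorphM /= rmorph_nat -mulrnAl zE numq_int.
Qed.

Lemma QAnn_diffP D : reflect (diff_act D g = 0) (D \in QAnn_diff g).
Proof.
rewrite unfold_in; apply: (iffP (asboolP _)) => [[N [D0 [N0 ND D0g]]]|Dg].
  move: D0g; rewrite /Ann_diff -ND diff_actMnl -scaler_nat => /eqP.
  by rewrite scaler_eq0 pnatr_eq0 eqn0Ngt N0 => /eqP.
have [N N0 [D0 ND]] := diff_integral D.
by exists N, D0; split=> //; rewrite /Ann_diff -ND diff_actMnl Dg mul0rn.
Qed.

Lemma QAnn_diff_zmod_closed : zmod_closed (QAnn_diff g).
Proof.
split=> [|D1 D2 /QAnn_diffP D1g /QAnn_diffP D2g]; apply/QAnn_diffP.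
  exact: diff_act0l.
by rewrite diff_actDl diff_actNl D1g D2g subr0.
Qed.

Lemma QAnn_diff_mulideal D1 :
  {in QAnn_diff g, forall D2, D1 * D2 \in QAnn_diff g}.
Proof.
by move=> D2 /QAnn_diffP D2g; apply/QAnn_diffP; rewrite diff_actM D2g linear0.
Qed.

HB.instance Definition _ :=
  GRing.isZmodClosed.Build (DiffQ L) (QAnn_diff g) QAnn_diff_zmod_closed.
HB.instance Definition _ :=
  isMulIdeal.Build (DiffQ L) (QAnn_diff g) QAnn_diff_mulideal.

Definition QA : Type := quot_ring (Ideal.clone (DiffQ L) (QAnn_diff g) _).
HB.instance Definition _ := GRing.ComPzRing.on QA.
HB.instance Definition _ := GRing.Lmodule.on QA.

Definition QA_class : DiffQ L -> QA :=
  @quot_pi _ _ (Ideal.clone (DiffQ L) (QAnn_diff g) _).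

HB.instance Definition _ := GRing.RMorphism.on QA_class.
HB.instance Definition _ := GRing.Linear.on QA_class.

Definition QA_act (a : QA) : polyOn L := diff_act (quot_repr a) g.

Lemma QA_act_class D : QA_act (QA_class D) = diff_act D g.
Proof.
apply/eqP; rewrite -subr_eq0 /QA_act -diff_actNl -diff_actDl.
exact/eqP/QAnn_diffP/quot_pi_reprP.
Qed.

Definition deg (a : QA) : rat := pfun (QA_act a) 0.

Lemma diff_act_dirder u h :
  diff_act (dirder u) h = \sum_(i < dim L) (coord u i)%:~R *: h^`M(i).
Proof.
rewrite -[LHS]/(diff_actl h _) linear_sum; apply: eq_bigr => i _.
by rewrite -[LHS]/(diff_act _ h) diff_actZl diff_actX mderivmU1m.
Qed.

Lemma msize_dirder u h : (msize (diff_act (dirder u) h) <= (msize h).-1)%N.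
Proof.
rewrite diff_act_dirder [msize _]msizeE; apply/bigmax_leqP_seq => m + _.
rewrite mcoeff_msupp linear_sum /= => mh.
have [i hi] : exists i, h@_(m + U_(i)) != 0.
  apply/existsP; apply: contraNT mh => /existsPn h0.
  rewrite big1 // => i _; rewrite mcoeffZ mcoeff_deriv.
  by have /negPn/eqP -> := h0 i; rewrite mul0rn mulr0.
move: hi; rewrite -mcoeff_msupp => /msize_mdeg_lt.
by rewrite mdegD mdeg1 addn1; case: (msize h).
Qed.

Lemma dirder_nilpotent u i : (msize g <= i)%N -> QA_class (dirder u) ^+ i = 0.
Proof.
move=> le; rewrite -rmorphXn -(linear0 QA_class); apply/quot_piP.
rewrite subr0; apply/QAnn_diffP/eqP; rewrite -msize_poly_eq0 -leqn0.
have {le}: (msize g - i <= 0)%N by rewrite leqn0 subn_eq0.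
apply: leq_trans; elim: i => [|i IH]; first by rewrite expr0 diff_act1 subn0.
rewrite exprS diff_actM (leq_trans (msize_dirder _ _)) //.
by rewrite subnS -!subn1 leq_sub2r.
Qed.

(* the exponential series of a class of [dirder u]: by [dirder_nilpotent] its
   terms vanish from [msize g] on *)
Definition expQA (a : QA) : QA := \sum_(i < msize g) (i`!%:R : rat)^-1 *: a ^+ i.

Definition ch : ShQ L -> QA := gr_lift (fun u => expQA (QA_class (dirder u))).

End DiffAct.

Definition ch_defines_iso (f g : polyOn L) : Prop :=
  exists phi : QK f -> QA g,
    [/\ forall E, phi (QK_class f E) = ch g E,
        linear phi, monoid_morphism phi & bijective phi].

End Lattice.

(* Main.v *)
(* By Taylor's formula [T^u] acts on polynomials as the exponential of the
   derivative along [u], so [ch E] acts on the derivatives of [g] as [E] does.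
   Hence [ch] is multiplicative, [ch E = 0] iff [E] kills [g], and [ch] is onto
   since, modulo nilpotents, [X] is recovered from [exp X - 1]. It therefore
   induces an isomorphism from [QK f] iff [f] and [g] are killed by the same
   shift operators, iff they are killed by the same differential operators.
   If [f] is a unit times [g] this is clear. Conversely, finite-dimensional
   duality writes each of [f] and [g] as a derivative of the other, say
   [f = D g] and [g = D' f]; then [D' D g = g] makes the class of [D] a unit. *)
Require Import Defs.
From HB Require Import structures.
From mathcomp Require Import all_boot all_order all_algebra.
From mathcomp Require Import -(notations) finmap monalg.
From mathcomp Require Import mpoly.
From mathcomp Require Import boolp.

Set Implicit Arguments.
Unset Strict Implicit.
Unset Printing Implicit Defensive.

Import GRing.Theory.
Local Open Scope ring_scope.

(** * Restriction to lines and Taylor's formula *)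

Lemma coordD (L : vectType int) (x y : L) i :
  Defs.coord (x + y) i = Defs.coord x i + Defs.coord y i.
Proof.
have [_ v2rD] := v2r_semilinear (VectorInternalTheory.v2r_subproof L).
by rewrite /Defs.coord [VectorInternalTheory.v2r _]v2rD mxE.
Qed.

Lemma coord_mulrz (L : vectType int) (x : L) (t : int) i :
  Defs.coord (x *~ t) i = t * Defs.coord x i.
Proof.
have [v2rZ _] := v2r_semilinear (VectorInternalTheory.v2r_subproof L).
by rewrite -scaler_int /Defs.coord [VectorInternalTheory.v2r _]v2rZ mxE intz.
Qed.

Section Taylor.
Variables (L : vectType int) (x u : L).
Implicit Types h : polyOn L.

Definition restrict_line h : {poly rat} :=
  mmap polyC (fun i => (Defs.coord x i)%:~R%:P + (Defs.coord u i)%:~R *: 'X) h.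

Lemma restrict_line_horner h (t : int) :
  (restrict_line h).[t%:~R] = pfun h (x + u *~ t).
Proof.
rewrite /pfun mevalE /restrict_line /mmap horner_sum; apply: eq_bigr => m _.
rewrite hornerM hornerC /mmap1 horner_prod; congr (_ * _).
apply: eq_bigr => j _; rewrite horner_exp hornerD hornerC hornerZ hornerX.
by rewrite coordD coord_mulrz rmorphD rmorphM /= mulrC.
Qed.

Lemma dirder_derivation h h' :
  diff_act (dirder u) (h * h')
    = diff_act (dirder u) h * h' + h * diff_act (dirder u) h'.
Proof.
rewrite !diff_act_dirder mulr_suml mulr_sumr -big_split; apply: eq_bigr => i _ /=.
by rewrite mderivM scalerDr scalerAl scalerAr.
Qed.

Lemma deriv_restrict_line h :
  (restrict_line h)^`() = restrict_line (diff_act (dirder u) h).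
Proof.
pose P h := (restrict_line h)^`() = restrict_line (diff_act (dirder u) h).
(* Both sides obey the Leibniz rule along [restrict_line], so only the variables remain to be
   checked. *)
have PM h1 h2 : P h1 -> P h2 -> P (h1 * h2).
  rewrite /P dirder_derivation /restrict_line mmapD !rmorphM /= derivM.
  by move=> -> ->.
have P1 : P 1.
  rewrite /P /restrict_line rmorph1 -polyC1 derivC diff_act_dirder big1 ?mmap0 // => i _.
  by rewrite -mpolyC1 mderivC scaler0.
elim/mpolyind: h => [|c m h _ _ IH].
  by rewrite linear0 /restrict_line mmap0 deriv0.
rewrite /restrict_line linearD !mmapD derivD IH; congr (_ + _).
rewrite linearZ /= !mmapZ derivM derivC mul0r add0r; congr (_ * _).
rewrite -[_ = _]/(P 'X_[m]) mpolyXE_id; apply: big_ind => // i _.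
elim: (m i) => [|k IHk]; rewrite ?expr0 // exprS; apply: PM => //.
rewrite /P /restrict_line mmapX mmap1U derivD derivC derivZ derivX add0r.
rewrite diff_act_dirder (bigD1 i) //= big1 ?addr0 => [|j ji].
  rewrite mderivX mnm1E eqxx -[X in (X - _)%MM]add0m addmK mpolyX0 scale1r mmapZ rmorph1.
  by rewrite -mul_polyC mulr1.
by rewrite mderivX mnm1E eq_sym (negPf ji) scale0r scaler0.
Qed.

Lemma msize_diff_act (D : DiffQ L) h : (msize (diff_act D h) <= msize h)%N.
Proof.
rewrite [msize _]msizeE; apply/bigmax_leqP_seq => m + _.
rewrite mcoeff_msupp /diff_act linear_sum /= => mh.
have [m' hm'] : exists m', h@_(m' + m) != 0.
  apply: contrapT => /forallNP h0; move/negP: mh; apply; apply/eqP.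
  apply: big1 => m' _; rewrite mcoeffZ mcoeff_mderivm.
  by have /negP/negPn/eqP -> := h0 m'; rewrite mul0rn mulr0.
move: hm'; rewrite -mcoeff_msupp => /msize_mdeg_lt; apply: leq_trans.
by rewrite ltnS mdegD leq_addl.
Qed.

Lemma dirder_exp_eq0 k h : (msize h <= k)%N -> diff_act (dirder u ^+ k) h = 0.
Proof.
move=> hk; suff /QAnn_diffP : dirder u ^+ k \in QAnn_diff h by [].
have := dirder_nilpotent u hk.
by rewrite -rmorphXn -(linear0 (QA_class h)) => /quot_piP; rewrite subr0.
Qed.

(** The truncation order [k] is independent of the polynomial acted on, so that one operator serves
    [f] and [g] at once. *)
Definition exp_dirder k : DiffQ L :=
  \sum_(i < k) (i`!%:R)^-1 *: dirder u ^+ i.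

(** This is the one-variable expansion of [restrict_line h] at 0, evaluated at 1. *)
Lemma taylor k h : (msize h <= k)%N ->
  pfun (diff_act (exp_dirder k) h) x = pfun h (x + u).
Proof.
move=> hk; set p := restrict_line h.
have derivE i : p^`(i) = restrict_line (diff_act (dirder u ^+ i) h).
  elim: i => [|i IH]; first by rewrite expr0 diff_act1.
  by rewrite derivnS IH deriv_restrict_line exprS diff_actM.
(* The [k]-th derivative of [p] vanishes, and in characteristic 0 this kills all coefficients of
   index at least [k]. *)
have pk : (size p <= k)%N.
  apply/leq_sizeP => j kj; have := congr1 (coefp (j - k)) (derivE k).
  rewrite dirder_exp_eq0 // /restrict_line mmap0 /= coef0 coef_derivn subnKC //.
  move/eqP; rewrite Num.Theory.mulrn_eq0 => /orP[|/eqP //].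
  by rewrite eqn0Ngt ffact_gt0 kj.
rewrite -[in RHS](mulr1z u) -restrict_line_horner -/p -[1%:~R]add0r.
rewrite (nderiv_taylor_wide (mulrC _ _) pk) /exp_dirder.
rewrite -[diff_act _ h]/(diff_actl h _) linear_sum /pfun raddf_sum.
apply: eq_bigr => i _; rewrite expr1n mulr1 linearZ /= mevalZ.
have /(congr1 (horner^~ 0)) /= := nderivn_def i p.
rewrite derivE -[0 in LHS]/(0%:~R) restrict_line_horner mulr0z addr0 /pfun => ->.
rewrite hornerMn -[X in _ * X]mulr_natl mulKf //.
by rewrite Num.Theory.pnatr_eq0 eqn0Ngt fact_gt0.
Qed.

End Taylor.

(** * The map [ch] and its action on derivatives of [g] *)

Section Chern.
Variable L : vectType int.
Implicit Types (f g h : polyOn L) (E : ShQ L) (D : DiffQ L).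

(** A lift of [ch] to differential operators, which can act on any polynomial and not only on
    [g]. *)
Definition ch_op k E : DiffQ L := gr_lift (fun u => exp_dirder u k) E.

Lemma sh_act_ch_op k E h : (msize h <= k)%N ->
  sh_act E (pfun h) = pfun (diff_act (ch_op k E) h).
Proof.
move=> hk; apply/funext => x; move: E; apply: (@gr_ext _ _ rat^o) => [||u].
- by move=> c E E'; rewrite sh_act_linear.
- by move=> c E E'; rewrite /ch_op linearP diff_actDl diff_actZl /pfun mevalD mevalZ.
by rewrite sh_act_shift /ch_op gr_lift_shift taylor.
Qed.

Lemma chE g E : ch g E = QA_class g (ch_op (msize g) E).
Proof.
move: E; apply: (@gr_ext _ _ (QA g)) => [||u].
- exact: gr_lift_is_linear.
- by move=> c E E'; rewrite /ch_op linearP linearP.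
rewrite /ch /ch_op !gr_lift_shift /expQA /exp_dirder.
elim: (msize g) => [|k IH]; first by rewrite !big_ord0 linear0.
by rewrite !big_ord_recr /= {}IH [RHS]linearD linearZ rmorphXn.
Qed.

(** Only annihilators of [g] are divided out. Identities in [QA g] can therefore be checked on
    polynomials. *)
Lemma QA_act_inj g : injective (@QA_act L g).
Proof.
move=> a b; rewrite -[a]quot_reprK -[b]quot_reprK !QA_act_class => ab.
apply/quot_piP/QAnn_diffP.
by rewrite diff_actDl diff_actNl ab subrr.
Qed.

Lemma QA_actM g D (a : QA g) : QA_act (QA_class g D * a) = diff_act D (QA_act a).
Proof. by rewrite -[a]quot_reprK -rmorphM !QA_act_class diff_actM. Qed.

(** [QA_act a] is obtained from [g] by a differential operator, so it stays within the bound
    [msize g] under which [ch_op] acts as [E]. *)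
Lemma QA_act_chM g E (a : QA g) :
  pfun (QA_act (ch g E * a)) = sh_act E (pfun (QA_act a)).
Proof.
rewrite chE QA_actM -sh_act_ch_op //.
exact: msize_diff_act.
Qed.

Lemma QA_act1 g : @QA_act L g 1 = g.
Proof. by rewrite -(rmorph1 (QA_class g)) QA_act_class diff_act1. Qed.

Lemma QA_act0 g : @QA_act L g 0 = 0.
Proof. by rewrite -(linear0 (QA_class g)) QA_act_class diff_act0l. Qed.

Lemma QA_act_ch g E : pfun (QA_act (ch g E)) = sh_act E (pfun g).
Proof. by rewrite -[ch g E]mulr1 QA_act_chM QA_act1. Qed.

(** * Differential operators realized by shift operators in bounded degree *)

Definition realizes k E D :=
  forall h, (msize h <= k)%N -> sh_act E (pfun h) = pfun (diff_act D h).

Definition realizable k D := exists E, realizes k E D.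

Lemma realizable_shift k k' u : (k <= k')%N -> realizable k (exp_dirder u k').
Proof.
move=> kk'; exists (shift u) => h hk; apply/funext => x.
by rewrite sh_act_shift taylor // (leq_trans hk).
Qed.

Lemma realizableP k c D D' :
  realizable k D -> realizable k D' -> realizable k (c *: D + D').
Proof.
move=> [E ED] [E' ED']; exists (c *: E + E') => h hk; apply/funext => x.
rewrite sh_act_linear (ED _ hk) (ED' _ hk) diff_actDl diff_actZl.
by rewrite /pfun mevalD mevalZ.
Qed.

(** Differential operators do not raise [msize], so the bound [k] survives composition. *)
Lemma realizableM k D D' :
  realizable k D -> realizable k D' -> realizable k (D * D').
Proof.
move=> [E ED] [E' ED']; exists (E * E') => h hk; apply/funext => x.
rewrite sh_actM (ED' _ hk) ED ?diff_actM //.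
exact: leq_trans (msize_diff_act _ _) hk.
Qed.

Lemma realizable0 k D :
  (forall h, (msize h <= k)%N -> diff_act D h = 0) -> realizable k D.
Proof.
move=> D0; exists 0 => h hk; apply/funext => x.
by rewrite sh_act0 D0 // /pfun meval0.
Qed.

Lemma realizable1 k : realizable k 1.
Proof.
exists (shift 0) => h hk; apply/funext => x.
by rewrite sh_act_shift addr0 diff_act1.
Qed.

(* With [X = dirder u], the series [Y = exp X - 1] is [X] times a polynomial
   of constant term 1. Hence [X ^ j * p X - p 0 *: Y ^ j] is a multiple of
   [X ^ j.+1], and descending induction on [j] applies as [X] is nilpotent. *)
Lemma realizable_horner k u (p : {poly rat}) :
  realizable k (dirder u * horner_alg (dirder u) p).
Proof.
(* Taking [k.+1] terms gives [q] constant term 1 even for [k = 0]; then ['X * q] is the exponential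
   series cut at [k.+2] terms, minus 1. *)
pose q : {poly rat} := \sum_(i < k.+1) (i.+1`!%:R)^-1 *: 'X^i.
pose F : {rmorphism {poly rat} -> DiffQ L} :=
  GRing.RMorphism.clone _ _ (horner_alg (dirder u)) _.
rewrite -[horner_alg _ _]/(F p).
have FX : F 'X = dirder u by apply: horner_algX.
have FZ c r : F (c *: r) = c *: F r.
  by rewrite -mul_polyC rmorphM [F c%:P]horner_algC mulr_algl.
have Y_real : realizable k (F ('X * q)).
  have -> : F ('X * q) = exp_dirder u k.+2 + (-1) *: 1.
    rewrite rmorphM rmorph_sum FX /exp_dirder [in RHS]big_ord_recl.
    rewrite [in RHS]invr1 scale1r expr0 scaleN1r addrAC subrr add0r mulr_sumr.
    by apply: eq_bigr => i _; rewrite FZ rmorphXn FX -scalerAr exprS.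
  rewrite addrC; apply: realizableP; first exact: realizable1.
  exact/realizable_shift/ltnW.
have Yj_real j : realizable k (F (('X * q) ^+ j)).
  elim: j => [|j IH]; first by rewrite expr0 rmorph1; apply: realizable1.
  by rewrite exprS rmorphM; apply: realizableM.
suff IH m j r : (k <= j + m)%N -> realizable k (F ('X^(j.+1) * r)).
  by rewrite -FX -rmorphM -['X]expr1; apply: (IH k 0).
elim: m j r => [|m IH] j {}p.
  rewrite addn0 => kj; apply: realizable0 => h hk; rewrite mulrC rmorphM rmorphXn FX.
  by rewrite diff_actM dirder_exp_eq0 ?linear0 // (leq_trans hk (leqW kj)).
move=> kjm.
have q0 : q.[0] = 1.
  rewrite /q horner_sum big_ord_recl big1 => [|i _].
    by rewrite hornerZ expr0 hornerC mulr1 invr1 addr0.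
  by rewrite hornerZ hornerXn expr0n mulr0.
have : root (p - p.[0] *: q ^+ j.+1) 0.
  by rewrite /root hornerD hornerN hornerZ horner_exp q0 expr1n mulr1 subrr.
case/factor_theorem => r; rewrite subr0 => rE.
have -> : 'X^(j.+1) * p = p.[0] *: ('X * q) ^+ j.+1 + 'X^(j.+2) * r.
  rewrite exprMn scalerAr [_ ^+ j.+2]exprSr -mulrA ['X * r]mulrC -rE -mulrDr.
  by rewrite addrC subrK.
rewrite rmorphD FZ; apply: realizableP; first exact: Yj_real.
by apply: IH; rewrite addSnnS.
Qed.


Lemma dirder_basis i :
  dirder (VectorInternalTheory.r2v (delta_mx 0 i) : L) = 'X_i.
Proof.
rewrite /dirder (bigD1 i) //= big1 => [|j /negPf ji];
  rewrite /Defs.coord VectorInternalTheory.r2vK mxE ?eqxx ?ji ?scale0r //.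
by rewrite scale1r addr0.
Qed.

(** Realizable operators form an algebra, which contains each ['X_i] as the derivative along a basis
    vector. *)
Lemma realizableT k D : realizable k D.
Proof.
have RX m : realizable k 'X_[m].
  rewrite mpolyXE_id; elim/big_ind: _ => [||i _]; first exact: realizable1.
    by move=> D1 D2; apply: realizableM.
  elim: (m i) => [|j IH]; rewrite ?expr0 ?exprS; first exact: realizable1.
  apply: realizableM IH; rewrite -dirder_basis.
  set u := VectorInternalTheory.r2v _.
  by have := realizable_horner k u 1%:P; rewrite horner_algC scale1r mulr1.
elim/mpolyind: D => [|c m D _ _ IH]; last exact: realizableP.
by apply: realizable0 => h _; rewrite diff_act0l.
Qed.

Lemma realizes_eq0 k E D h : realizes k E D -> (msize h <= k)%N ->
  (forall x, sh_act E (pfun h) x = 0) <-> diff_act D h = 0.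
Proof.
move=> ED hk; rewrite (ED _ hk); split=> [Dh0|-> x];
  last by rewrite /pfun meval0.
by apply: pfun_inj; apply/funext => x; rewrite Dh0 /pfun meval0.
Qed.

Lemma ch_surj g (a : QA g) : exists E, ch g E = a.
Proof.
have [E ED] := realizableT (msize g) (quot_repr a); exists E.
by apply/QA_act_inj/pfun_inj; rewrite QA_act_ch ED.
Qed.

Lemma ch_eq0 g E : ch g E = 0 <-> forall x, sh_act E (pfun g) x = 0.
Proof.
rewrite -QA_act_ch; split=> [-> x|E0]; first by rewrite QA_act0 /pfun meval0.
apply/QA_act_inj/pfun_inj/funext => x; rewrite E0.
by rewrite QA_act0 /pfun meval0.
Qed.

(** * Duality between operators and polynomials *)

Lemma mcoeff0_diff_act D h k : (msize D <= k)%N ->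
  (diff_act D h)@_0 =
    \sum_(m : 'X_{1..(dim L) < k}) D@_m * (h@_m *+ \prod_(i < dim L) (m i)`!).
Proof.
move=> Dk; rewrite (diff_actEw _ Dk) linear_sum; apply: eq_bigr => m _ /=.
rewrite mcoeffZ mcoeff_mderivm addm0; congr (_ * (_ *+ _)).
by apply: eq_bigr => i _; rewrite ffactnn.
Qed.

Lemma mpoly_eq0_mcoeff0 h k : (msize h <= k)%N ->
  (forall m : 'X_{1..(dim L) < k}, (h^`M[m])@_0 = 0) -> h = 0.
Proof.
move=> hk h0; apply/mpolyP => m; rewrite mcoeff0.
have [mk|km] := ltnP (mdeg m) k; last first.
  apply: memN_msupp_eq0; apply: contraL km => /msize_mdeg_lt mh.
  by rewrite -ltnNge (leq_trans mh).
have /eqP := h0 (BMultinom mk); rewrite mcoeff_mderivm addm0 Num.Theory.mulrn_eq0.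
case/orP => [|/eqP //]; rewrite eqn0Ngt prodn_gt0 // => i.
by rewrite ffactnn fact_gt0.
Qed.

(* The derivatives of [g] span the orthogonal of [Ann g] for the pairing
   [(D, h) |-> (D h)(0)], by finite-dimensional duality: the kernel of the
   matrix of derivatives of [g] consists of the annihilators of [g]. *)
Lemma sub_Ann_act f g :
  (forall D, diff_act D g = 0 -> diff_act D f = 0) ->
  exists D, diff_act D g = f.
Proof.
move=> gf; pose k := maxn (msize f) (msize g).
pose I := 'X_{1..(dim L) < k}; pose N := #|{: I}|.
have fk : (msize f <= k)%N by rewrite leq_maxl.
have gk : (msize g <= k)%N by rewrite leq_maxr.
pose row_of h : 'rV[rat]_N := \row_j h@_(enum_val j : I).
pose M : 'M[rat]_N := \matrix_i row_of g^`M[(enum_val i : I)].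
have row_of_inj h h' : (msize h <= k)%N -> (msize h' <= k)%N ->
    row_of h = row_of h' -> h = h'.
  move=> hk h'k /rowP e; apply/mpolyP => m.
  have [mk|km] := ltnP (mdeg m) k.
    by have := e (enum_rank (BMultinom mk : I)); rewrite !mxE enum_rankK.
  by rewrite !memN_msupp_eq0 //; apply: contraL km => /msize_mdeg_lt mh;
    rewrite -ltnNge (leq_trans mh).
suff /submxP[v vE] : (row_of f <= M)%MS.
  pose D : DiffQ L := \sum_i v 0 i *: 'X_[(enum_val i : I)].
  exists D; apply: row_of_inj => //;
    first exact: leq_trans (msize_diff_act _ _) gk.
  rewrite vE; apply/rowP => j; rewrite !mxE.
  rewrite -[diff_act D g]/(diff_actl g D) (linear_sum (diff_actl g)) raddf_sum.
  apply: eq_bigr => i _; rewrite linearZ /= mcoeffZ -[diff_actl g _]/(diff_act _ g).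
  by rewrite diff_actX !mxE.
(* Membership in the row space is tested against each column [w] of the cokernel of [M], read below
   as an operator [D] killing [g]. *)
rewrite submxE; apply/eqP/rowP => j; rewrite [RHS]mxE.
pose w := col j (cokermx M).
pose fac (m : I) : rat := (\prod_(i < dim L) (m i)`!)%:R.
have facN0 m : fac m != 0.
  rewrite Num.Theory.pnatr_eq0 eqn0Ngt prodn_gt0 // => i; exact: fact_gt0.
(* Dividing by [fac m] cancels the factorials of the pairing, which becomes the dot product with
   [w]. *)
pose D : DiffQ L := \sum_(m : I) (w (enum_rank m) 0 / fac m) *: 'X_[m].
have DE (m : I) : D@_m = w (enum_rank m) 0 / fac m.
  rewrite /D linear_sum (bigD1 m) //= big1 => [|m' /negPf m'm].
    by rewrite mcoeffZ mcoeffX eqxx mulr1 addr0.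
  by rewrite mcoeffZ mcoeffX -bmeqP m'm mulr0.
have Dk : (msize D <= k)%N.
  rewrite [msize D]msizeE; apply/bigmax_leqP_seq => m + _.
  rewrite mcoeff_msupp; apply: contraR; rewrite -ltnNge ltnS => km.
  rewrite /D linear_sum big1 //= => m' _; rewrite mcoeffZ mcoeffX.
  case: eqP => [m'm|]; last by rewrite mulr0.
  by move: (bmdeg m'); rewrite m'm ltnNge km.
have pairing h : (diff_act D h)@_0 = (row_of h *m w) 0 0.
  rewrite (mcoeff0_diff_act _ Dk) mxE (reindex_onto (enum_val : 'I_N -> I) enum_rank).
    apply: eq_big => [i|i _]; first by rewrite enum_valK eqxx.
    rewrite DE enum_valK -mulr_natr -/(fac _) [RHS]mulrC [row_of h _ _]mxE.
    by rewrite mulrA mulrAC divfK.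
  by move=> m _; rewrite enum_rankK.
have Dg : diff_act D g = 0.
  apply: (@mpoly_eq0_mcoeff0 _ k);
    first exact: leq_trans (msize_diff_act _ _) gk.
  (* Since operators commute, the [m]-th derivative of [D g] at 0 pairs [D] with a row of [M], which
     [w] annihilates. *)
  move=> m; rewrite -diff_actX -diff_actM mulrC diff_actM diff_actX pairing.
  have -> : row_of g^`M[m] = row (enum_rank m) M by rewrite rowK enum_rankK.
  by rewrite -row_mul /w colE mulmxA mulmx_coker mul0mx row0 mxE.
have := congr1 (mcoeff 0) (gf _ Dg); rewrite pairing mcoeff0 => <-.
by rewrite !mxE; apply: eq_bigr => i _; rewrite !mxE.
Qed.

(** * Isomorphisms, annihilators and units *)

Lemma ch_defines_iso_ker f g : ch_defines_iso f g ->
  forall D, diff_act D g = 0 <-> diff_act D f = 0.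
Proof.
move=> [phi [phiE philin _ /bij_inj phi_inj]] D.
pose k := maxn (msize f) (msize g).
(* With [k] bounding both sizes, a single [E] acts as [D] on [f] and on [g]. *)
have [E ED] := realizableT k D.
rewrite -(realizes_eq0 ED (leq_maxl _ _)) -(realizes_eq0 ED (leq_maxr _ _)).
rewrite -ch_eq0 -phiE.
have phi0 : phi 0 = 0.
  by have := philin (-1) 0 0; rewrite scaler0 addr0 scaleN1r addNr.
split=> [e|Ef].
  have : QK_class f E = QK_class f 0.
    by apply: phi_inj; rewrite e [QK_class f 0]raddf0.
  by move/quot_piP; rewrite subr0 => /QAnn_shP.
have -> : QK_class f E = QK_class f 0.
  by apply/quot_piP; rewrite subr0; apply/QAnn_shP.
by rewrite [QK_class f 0]raddf0.
Qed.

Lemma ch_is_linear g : linear (@ch L g).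
Proof. exact: gr_lift_is_linear. Qed.

Lemma ch_is_monoid_morphism g : monoid_morphism (@ch L g).
Proof.
split=> [|E E'].
  apply/QA_act_inj/pfun_inj/funext => x.
  by rewrite QA_act_ch QA_act1 sh_act_shift addr0.
apply/QA_act_inj/pfun_inj/funext => x.
by rewrite QA_act_ch QA_act_chM QA_act_ch sh_actM.
Qed.

(** [E] acts on [f] as [ch g E * td] acts on [g]. Cancelling [td] shows that the kernel of [ch g] is
    the annihilator of [f]; surjectivity of [ch g] does the rest. *)
Lemma unit_ch_defines_iso f g (td : QA g) :
  is_unit td -> QA_act td = f -> ch_defines_iso f g.
Proof.
move=> [td' tdK] tdf.
have kerE E : ch g E = 0 <-> E \in QAnn_sh f.
  have act_tdE : pfun (QA_act (ch g E * td)) = sh_act E (pfun f).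
    by rewrite QA_act_chM tdf.
  split=> [E0|/QAnn_shP Ef].
    apply/QAnn_shP => x; rewrite -act_tdE E0 mul0r.
    by rewrite QA_act0 /pfun meval0.
  suff td0 : ch g E * td = 0 by rewrite -[ch g E]mulr1 -tdK mulrA td0 mul0r.
  apply/QA_act_inj/pfun_inj/funext => x; rewrite act_tdE Ef.
  by rewrite QA_act0 /pfun meval0.
have ch_eq E E' : ch g E = ch g E' <-> QK_class f E = QK_class f E'.
  have chB : ch g (E - E') = ch g E - ch g E'.
    by rewrite addrC -scaleN1r ch_is_linear scaleN1r addrC.
  split=> [e|/quot_piP/kerE]; first by apply/quot_piP/kerE; rewrite chB e subrr.
  by rewrite chB => /eqP; rewrite subr_eq0 => /eqP.
pose phi (x : QK f) : QA g := ch g (quot_repr x).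
have phiE E : phi (QK_class f E) = ch g E by apply/ch_eq; exact: quot_reprK.
have QKK x : QK_class f (quot_repr x) = x by exact: quot_reprK.
have [psi psiE] : exists psi : QA g -> ShQ L, forall a, ch g (psi a) = a.
  by exists (fun a => sval (cid (ch_surj a))) => a; case: cid.
exists phi; split=> //.
- move=> c x y; rewrite -[x]QKK -[y]QKK.
  have -> : c *: QK_class f (quot_repr x) + QK_class f (quot_repr y)
             = QK_class f (c *: quot_repr x + quot_repr y).
    by rewrite /QK_class linearP.
  by rewrite !phiE ch_is_linear.
- have [ch1 chM] := ch_is_monoid_morphism g.
  split=> [|x y]; first by rewrite -[1]/(QK_class f 1) phiE ch1.
  rewrite -[x]QKK -[y]QKK.
  have -> : QK_class f (quot_repr x) * QK_class f (quot_repr y)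
             = QK_class f (quot_repr x * quot_repr y).
    by rewrite /QK_class rmorphM.
  by rewrite !phiE chM.
exists (fun a => QK_class f (psi a)) => [x|a]; last by rewrite phiE psiE.
by rewrite -[RHS]QKK; apply/ch_eq; rewrite psiE.
Qed.

End Chern.

Theorem theorem1p1 (L : vectType int) (f g : polyOn L) (d : nat)
    (hg : g \is d.-homog) :
  (ch_defines_iso f g <-> exists td : QA g, is_unit td /\ QA_act td = f)
  /\ (forall td : QA g, is_unit td ->
        (QA_act td = f <-> forall E : ShQ L, chi f E = deg (td * ch g E))).
Proof.
split=> [|td _].
  split=> [/ch_defines_iso_ker gfE|[td [tdU tdf]]]; last first.
    exact: unit_ch_defines_iso tdU tdf.
  have [D Dg] : exists D, diff_act D g = f.
    by apply: sub_Ann_act => D /gfE.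
  have [D' Df] : exists D', diff_act D' f = g.
    by apply: sub_Ann_act => D' /gfE.
  exists (QA_class g D); rewrite QA_act_class; split=> //.
  exists (QA_class g D'); apply: QA_act_inj.
  by rewrite mulrC QA_actM QA_act_class Dg QA_act1.
have degE E : deg (td * ch g E) = sh_act E (pfun (QA_act td)) 0.
  by rewrite /deg mulrC QA_act_chM.
split=> [tdf E|chiE]; first by rewrite degE tdf.
(* For [E = shift u], the identity at 0 compares the values of [f] and [QA_act td] at [u]. *)
apply/esym/pfun_inj/funext => u; have := chiE (shift u).
by rewrite degE /chi !sh_act_shift add0r.
Qed.
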